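(* Let $A$ be a dense subset of a uniform space $X$. Then there is an S-deformation retraction $r:{}^{\ast}X\to{}^{\ast}A$.
   Context: Nonstandard setting: fix a standard universe $\mathbb{U}$ satisfying sufficiently many axioms of ZFC and containing all standard objects considered (uniform spaces are standard), and an elementary extension ${}^{\ast}\mathbb{U}$ of $\mathbb{U}$ (the internal universe) that is $|\mathbb{U}|^{+}$-saturated; $x\mapsto{}^{\ast}x$ is the elementary embedding. ''Internal'' means belonging to ${}^{\ast}\mathbb{U}$. For a uniform space $X$, points $x,y\in{}^{\ast}X$ are infinitely close, $x\approx y$, if $(x,y)\in{}^{\ast}U$ for every entourage $U$ of $X$. Subsets of uniform spaces carry the subspace uniformity, and products the product uniformity. An internal map $f:{}^{\ast}X\to{}^{\ast}Y$ is S-continuous at $x\in{}^{\ast}X$ if $f(y)\approx f(x)$ for all $y\approx x$; it is S-continuous if it is so at every $x\in{}^{\ast}X$. S-continuous maps $f,g:{}^{\ast}X\to{}^{\ast}Y$ are S-homotopic if there is an S-continuous map $h:{}^{\ast}X\times{}^{\ast}[0,1]\to{}^{\ast}Y$ (where ${}^{\ast}X\times{}^{\ast}[0,1]={}^{\ast}(X\times[0,1])$, $[0,1]$ with its usual uniformity) with $h(\cdot,0)=f$ and $h(\cdot,1)=g$. Let $A\subseteq X$ and let $i:{}^{\ast}A\hookrightarrow{}^{\ast}X$ be the inclusion. An S-retraction is an S-continuous map $r:{}^{\ast}X\to{}^{\ast}A$ with $ri=\mathrm{id}_{{}^{\ast}A}$. An S-retraction $r$ is an S-deformation retraction if $ir$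 is S-homotopic to $\mathrm{id}_{{}^{\ast}X}$. *)

(* Defs.v *)
From mathcomp Require Import all_boot all_order all_algebra.
From mathcomp Require Import all_classical all_reals all_analysis.

Set Implicit Arguments.
Unset Strict Implicit.
Unset Printing Implicit Defensive.

Import Order.TTheory GRing.Theory Num.Theory.
Import numFieldNormedType.Exports.
Local Open Scope classical_set_scope.

Record eps_structure := EpsStructure {
  dom :> Type;
  eps : dom -> dom -> Prop }.

(* Formulas of the language of set theory; variables are de Bruijn indices. *)
Inductive formula : Type :=
| fEps of nat & nat
| fEq of nat & nat
| fNot of formula
| fAnd of formula & formula
| fAll of formula.

Definition scons (T : Type) (a : T) (v : nat -> T) (n : nat) : T :=
  if n is m.+1 then v m else a.

Fixpoint sat (M : eps_structure) (v : nat -> M) (phi : formula) : Prop :=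
  match phi with
  | fEps i j => eps (v i) (v j)
  | fEq i j => v i = v j
  | fNot a => ~ sat v a
  | fAnd a b => sat v a /\ sat v b
  | fAll a => forall x : M, sat (scons x v) a
  end.

Section SetTheory.
Variable M : eps_structure.
Implicit Types (a b p x y z : M).

Definition is_upair p a b := forall z, eps z p <-> z = a \/ z = b.

(* Kuratowski: p = {{a}, {a, b}} *)
Definition is_pair p a b :=
  exists s d, [/\ is_upair s a a, is_upair d a b & is_upair p s d].

(* Zermelo set theory with choice, the fragment of ZFC required of the
   standard universe. *)
Record ZC : Prop := {
  ZC_ext : forall a b, (forall z, eps z a <-> eps z b) -> a = b;
  ZC_pairing : forall a b, exists p, is_upair p a b;
  ZC_union : forall a, exists u,
    forall z, eps z u <-> exists y, eps z y /\ eps y a;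
  ZC_power : forall a, exists p,
    forall z, eps z p <-> forall y, eps y z -> eps y a;
  ZC_infinity : exists w,
    (exists e, eps e w /\ forall z, ~ eps z e) /\
    (forall x, eps x w ->
       exists y, eps y w /\ forall z, eps z y <-> eps z x \/ z = x);
  ZC_separation : forall (phi : formula) (v : nat -> M) a, exists b,
    forall z, eps z b <-> eps z a /\ sat (scons z v) phi;
  ZC_choice : forall a,
    (forall x, eps x a -> exists z, eps z x) ->
    (forall x y z, eps x a -> eps y a -> eps z x -> eps z y -> x = y) ->
    exists c, forall x, eps x a -> exists! z, eps z x /\ eps z c }.

End SetTheory.

Definition elementary (M N : eps_structure) (j : M -> N) :=
  forall (phi : formula) (v : nat -> M), sat v phi <-> sat (j \o v) phi.

(* |K|^+-saturation: a 1-type over a parameter set B with |B| < |K|^+, that is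
   |B| <= |K|, is realized as soon as it is finitely satisfiable. A member
   (phi, v) of the type has variable 0 of phi as its free variable, and v
   supplies the parameters. *)
Definition saturated_succ (K : Type) (M : eps_structure) :=
  forall (B : set M) (tp : set (formula * (nat -> M))),
    (B #<= [set: K])%card ->
    (forall q, tp q -> forall n, B (q.2 n)) ->
    (forall F, finite_set F -> F `<=` tp ->
       exists x, forall q, F q -> sat (scons x q.2) q.1) ->
    exists x, forall q, tp q -> sat (scons x q.2) q.1.

Record nonstandard_universe := NonstandardUniverse {
  stdU : eps_structure;
  intU : eps_structure;
  emb : stdU -> intU;
  stdU_ZC : ZC stdU;
  emb_elementary : elementary emb;
  intU_saturated : saturated_succ stdU intU }.

Arguments emb : clear implicits.
Arguments emb_elementary : clear implicits.

Section Formulas.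

Definition fOr a b := fNot (fAnd (fNot a) (fNot b)).
Definition fImp a b := fNot (fAnd a (fNot b)).
Definition fIff a b := fAnd (fImp a b) (fImp b a).
Definition fEx a := fNot (fAll (fNot a)).
Definition fUpair p a b :=
  fAll (fIff (fEps 0 p.+1) (fOr (fEq 0 a.+1) (fEq 0 b.+1))).
Definition fPair p a b :=
  fEx (fEx (fAnd (fUpair 1 a.+2 a.+2)
                 (fAnd (fUpair 0 a.+2 b.+2) (fUpair p.+2 1 0)))).

Variables (M : eps_structure) (v : nat -> M).

Lemma sat_or a b : sat v (fOr a b) <-> sat v a \/ sat v b.
Proof.
rewrite /fOr /=; split; last by tauto.
by move=> h; apply: contrapT => k; apply: h; tauto.
Qed.

Lemma sat_imp a b : sat v (fImp a b) <-> (sat v a -> sat v b).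
Proof.
rewrite /fImp /=; split; last by tauto.
by move=> h k; apply: contrapT => l; apply: h.
Qed.

Lemma sat_iff a b : sat v (fIff a b) <-> (sat v a <-> sat v b).
Proof.
have := sat_imp a b; have := sat_imp b a; rewrite /fIff [sat v (fAnd _ _)]/=.
by tauto.
Qed.

Lemma sat_ex a : sat v (fEx a) <-> exists x, sat (scons x v) a.
Proof.
rewrite /fEx /=; split=> [h|[x xa] h]; last exact: (h x).
by apply: contrapT => k; apply: h => x xa; apply: k; exists x.
Qed.

End Formulas.

Lemma sat_upair (M : eps_structure) (v : nat -> M) p a b :
  sat v (fUpair p a b) <-> is_upair (v p) (v a) (v b).
Proof.
have E z : sat (scons z v) (fIff (fEps 0 p.+1) (fOr (fEq 0 a.+1) (fEq 0 b.+1)))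
    <-> (eps z (v p) <-> z = v a \/ z = v b).
  by rewrite (propext (sat_iff _ _ _)) (propext (sat_or _ _ _)).
by split=> h z; apply/E; exact: h.
Qed.

Lemma sat_pair (M : eps_structure) (v : nat -> M) p a b :
  sat v (fPair p a b) <-> is_pair (v p) (v a) (v b).
Proof.
rewrite /fPair; split.
  move=> /sat_ex[s /sat_ex[d [/sat_upair h1 [/sat_upair h2 /sat_upair h3]]]].
  by exists s, d.
move=> [s [d [h1 h2 h3]]]; apply/sat_ex; exists s; apply/sat_ex; exists d.
by split; [|split]; apply/sat_upair.
Qed.

Section Pairs.
Variables (M : eps_structure) (ZM : ZC M).

Lemma is_upair_uniq (p q a b : M) : is_upair p a b -> is_upair q a b -> p = q.
Proof. by move=> h k; apply: (ZC_ext ZM) => z; rewrite h k. Qed.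

Lemma is_pair_ex (a b : M) : exists p, is_pair p a b.
Proof.
have [s hs] := ZC_pairing ZM a a; have [d hd] := ZC_pairing ZM a b.
by have [p hp] := ZC_pairing ZM s d; exists p, s, d.
Qed.

Lemma is_pair_uniq (p q a b : M) : is_pair p a b -> is_pair q a b -> p = q.
Proof.
move=> [s [d [h1 h2 h3]]] [s' [d' [k1 k2 k3]]].
move: h3 k3; rewrite (is_upair_uniq h1 k1) (is_upair_uniq h2 k2).
exact: is_upair_uniq.
Qed.

Lemma is_pair_inj (p a b a' b' : M) :
  is_pair p a b -> is_pair p a' b' -> a = a' /\ b = b'.
Proof.
move=> [s [d [h1 h2 h3]]] [s' [d' [k1 k2 k3]]].
have sa : eps a s by apply/h1; left.
have da : eps a d by apply/h2; left.
have db : eps b d by apply/h2; right.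
have sa' : eps a' s' by apply/k1; left.
have da' : eps a' d' by apply/k2; left.
have db' : eps b' d' by apply/k2; right.
have ps : s = s' \/ s = d' by apply/k3/h3; left.
have pd : d = s' \/ d = d' by apply/k3/h3; right.
have ps' : s' = s \/ s' = d by apply/h3/k3; left.
have pd' : d' = s \/ d' = d by apply/h3/k3; right.
have aa' : a = a'.
  have : eps a' s by case: ps => ->.
  by move/h1; case.
subst a'; split=> //.
have H1 (x : M) : eps x s -> x = a by move/h1; tauto.
have H1' (x : M) : eps x s' -> x = a by move/k1; tauto.
case: pd => E.
  have ba : b = a by apply: H1'; rewrite -E.
  have : b' = a by case: pd' => F; apply: H1'; rewrite -?E -?F //;
    rewrite F in db'; have := H1 _ db' => ->.
  by rewrite ba.
have : eps b d' by rewrite -E.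
move=> /k2[ba|//]; have : eps b' d by rewrite E.
by move=> /h2[b'a|//]; rewrite ba b'a.
Qed.

Definition kpair (a b : M) : M := sval (cid (is_pair_ex a b)).

Lemma kpairP (a b : M) : is_pair (kpair a b) a b.
Proof. exact: (svalP (cid (is_pair_ex a b))). Qed.

Lemma prod_ex (a b : M) : exists c, forall z,
  eps z c <-> exists x y, [/\ eps x a, eps y b & is_pair z x y].
Proof.
have [ab hab] := ZC_pairing ZM a b.
have [u hu] := ZC_union ZM ab.
have [p hp] := ZC_power ZM u.
have [pp hpp] := ZC_power ZM p.
pose phi := fEx (fEx (fAnd (fEps 1 3) (fAnd (fEps 0 4) (fPair 2 1 0)))).
have [c hc] := ZC_separation ZM phi (scons a (scons b (fun=> a))) pp.
exists c => z; rewrite hc; split.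
  move=> [_ /sat_ex[x /sat_ex[y [xa [yb /sat_pair h]]]]].
  by exists x, y.
move=> [x [y [xa yb h]]]; split; last first.
  apply/sat_ex; exists x; apply/sat_ex; exists y.
  by split=> //; split=> //; apply/sat_pair.
have ux : eps x u by apply/hu; exists a; split=> //; apply/hab; left.
have uy : eps y u by apply/hu; exists b; split=> //; apply/hab; right.
case: h => s [d [h1 h2 h3]].
by apply/hpp => t /h3[] -> {t}; apply/hp => w;
  [move=> /h1[] ->|move=> /h2[] ->].
Qed.

End Pairs.

(* A Rocq type T "belongs to U" when it is put in bijection with the extension
   of an element of U. *)
Record std_set (U : eps_structure) (T : Type) := StdSet {
  code : U;
  enc : T -> U;
  enc_inj : injective enc;
  codeP : forall u : U, eps u code <-> exists x, u = enc x }.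

Definition codes_rel (U : eps_structure) (T : Type) (s : std_set U T) (e : U)
    (E : set (T * T)) :=
  forall z, eps z e <-> exists x y, E (x, y) /\ is_pair z (enc s x) (enc s y).

(* A uniform space belongs to U when its underlying set, all its entourages and
   the set of its entourages do. *)
Record std_uniform (U : eps_structure) (X : uniformType) := StdUniform {
  us_set :> std_set U X;
  us_entourage : forall E : set (X * X), entourage E ->
    exists e, codes_rel us_set e E;
  us_uniformity : exists w : U, forall e, eps e w <->
    exists E : set (X * X), entourage E /\ codes_rel us_set e E }.

Record std_subset (U : eps_structure) (T : Type) (s : std_set U T)
    (A : set T) := StdSubset {
  sub_code : U;
  sub_codeP : forall u : U, eps u sub_code <-> exists x, A x /\ u = enc s x }.

Section Derived.
Variable U : eps_structure.

Section Subset.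
Variables (T : Type) (s : std_set U T) (A : set T) (a : std_subset s A).

Lemma std_sub_inj : injective (fun x : set_type A => enc s (set_val x)).
Proof.
move=> x y h; have := enc_inj h; rewrite !set_valE; exact: val_inj.
Qed.

Lemma std_sub_codeP (u : U) :
  eps u (sub_code a) <-> exists x : set_type A, u = enc s (set_val x).
Proof.
rewrite sub_codeP; split=> [[x [Ax ->]]|[x ->]].
  by exists (SigSub (mem_set Ax)); rewrite set_valE.
by exists (set_val x); split=> //; exact: set_valP.
Qed.

Definition std_sub : std_set U (set_type A) :=
  StdSet std_sub_inj std_sub_codeP.

End Subset.

Section Product.
Variables (ZU : ZC U) (S T : Type) (s : std_set U S) (t : std_set U T).

Lemma std_prod_inj :
  injective (fun p : S * T => kpair ZU (enc s p.1) (enc t p.2)).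
Proof.
move=> [x y] [x' y'] /= h.
have := kpairP ZU (enc s x) (enc t y); rewrite h => /is_pair_inj.
by move=> /(_ _ _ (kpairP _ _ _))[hx hy]; rewrite (enc_inj hx) (enc_inj hy).
Qed.

Lemma std_prod_codeP (u : U) :
  eps u (sval (cid (prod_ex ZU (code s) (code t)))) <->
  exists p : S * T, u = kpair ZU (enc s p.1) (enc t p.2).
Proof.
rewrite (svalP (cid (prod_ex ZU (code s) (code t)))); split.
  move=> [_ [_ [/codeP[x ->] /codeP[y ->] h]]]; exists (x, y).
  exact: is_pair_uniq h (kpairP _ _ _).
move=> [[x y] ->]; exists (enc s x), (enc t y).
by split; [apply/codeP; exists x|apply/codeP; exists y|exact: kpairP].
Qed.

Definition std_prod : std_set U (S * T)%type :=
  StdSet std_prod_inj std_prod_codeP.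

End Product.
End Derived.

Section UnitInterval.
Local Open Scope ring_scope.

Definition unit_interval (R : realType) : set R := `[0, 1]%classic.

Arguments unit_interval : clear implicits.

Lemma unit_interval0 (R : realType) : (0 : R) \in unit_interval R.
Proof. by rewrite inE /unit_interval /= in_itv /= lexx ler01. Qed.

Lemma unit_interval1 (R : realType) : (1 : R) \in unit_interval R.
Proof. by rewrite inE /unit_interval /= in_itv /= lexx ler01. Qed.

Arguments unit_interval0 : clear implicits.
Arguments unit_interval1 : clear implicits.

Definition I0 (R : realType) : set_type (unit_interval R) :=
  exist _ 0 (unit_interval0 R).
Definition I1 (R : realType) : set_type (unit_interval R) :=
  exist _ 1 (unit_interval1 R).

End UnitInterval.
Arguments unit_interval : clear implicits.
Arguments I0 : clear implicits.
Arguments I1 : clear implicits.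

Section Star.
Variable N : nonstandard_universe.

Definition star (T : Type) (s : std_set (stdU N) T) : Type :=
  {y : intU N | eps y (emb N (code s))}.

Lemma star_of_subproof (T : Type) (s : std_set (stdU N) T) (x : T) :
  eps (emb N (enc s x)) (emb N (code s)).
Proof.
have /= <- := emb_elementary N (fEps 0 1)
  (scons (enc s x) (fun=> code s)).
by apply/codeP; exists x.
Qed.

Definition star_of (T : Type) (s : std_set (stdU N) T) (x : T) : star s :=
  exist _ (emb N (enc s x)) (star_of_subproof s x).

Lemma star_incl_subproof (T : Type) (s : std_set (stdU N) T) (A : set T)
    (a : std_subset s A) (y : star (std_sub a)) :
  eps (sval y) (emb N (code s)).
Proof.
pose v := scons (sub_code a) (fun=> code s).
have [h _] := emb_elementary N (fAll (fImp (fEps 0 1) (fEps 0 2))) v.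
have {}h : sat (emb N \o v) (fAll (fImp (fEps 0 1) (fEps 0 2))).
  apply: h => x; apply/(sat_imp (scons x v) (fEps 0 1) (fEps 0 2)).
  by move=> /sub_codeP[z [_ xE]]; apply/codeP; exists z.
have /(sat_imp _ (fEps 0 1) (fEps 0 2)) := h (sval y).
by apply; exact: (svalP y).
Qed.

Definition star_incl (T : Type) (s : std_set (stdU N) T) (A : set T)
    (a : std_subset s A) (y : star (std_sub a)) : star s :=
  exist _ (sval y) (star_incl_subproof y).

Lemma star_pair_subproof (S T : Type) (s : std_set (stdU N) S)
    (t : std_set (stdU N) T) (x : star s) (y : star t) :
  exists p : star (std_prod (stdU_ZC N) s t), is_pair (sval p) (sval x) (sval y).
Proof.
pose c := code (std_prod (stdU_ZC N) s t).
pose v := scons (code s) (scons (code t) (fun=> c)).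
pose hyp := fAnd (fEps 1 2) (fEps 0 3).
pose ccl := fEx (fAnd (fPair 0 2 1) (fEps 0 5)).
have [h _] := emb_elementary N (fAll (fAll (fImp hyp ccl))) v.
have {}h : sat (emb N \o v) (fAll (fAll (fImp hyp ccl))).
  apply: h => a b; apply/(sat_imp (scons b (scons a v)) hyp ccl).
  move=> -[/codeP[a' ea] /codeP[b' eb]]; rewrite /= in ea eb.
  apply/sat_ex; exists (enc (std_prod (stdU_ZC N) s t) (a', b')).
  split; first by apply/sat_pair; rewrite /= ea eb; exact: kpairP.
  by apply/codeP; exists (a', b').
have /(sat_imp _ hyp ccl) := h (sval x) (sval y).
move=> /(_ (conj (svalP x) (svalP y))) /sat_ex[p [/sat_pair ph pc]].
by exists (exist _ p pc).
Qed.

Definition star_pair (S T : Type) (s : std_set (stdU N) S)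
    (t : std_set (stdU N) T) (x : star s) (y : star t) :
    star (std_prod (stdU_ZC N) s t) :=
  sval (cid (star_pair_subproof x y)).

(* For X itself every entourage has a code. For a subspace or a product, those
   having one form a base (traces, resp. products, of coded entourages), so no
   generality is lost by quantifying over coded entourages only. *)
Definition inf_close (X : uniformType) (s : std_set (stdU N) X)
    (x y : star s) :=
  forall (E : set (X * X)) (e : stdU N), entourage E -> codes_rel s e E ->
    exists p, is_pair p (sval x) (sval y) /\ eps p (emb N e).

(* The graph of f is an element of the internal universe. *)
Definition internal (S T : Type) (s : std_set (stdU N) S)
    (t : std_set (stdU N) T) (f : star s -> star t) :=
  exists g : intU N, forall z,
    eps z g <-> exists x, is_pair z (sval x) (sval (f x)).

Section Maps.
Variables (X Y : uniformType).
Variables (s : std_set (stdU N) X) (t : std_set (stdU N) Y).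

Definition S_continuous_at (f : star s -> star t) (x : star s) :=
  forall y, inf_close y x -> inf_close (f y) (f x).

Definition S_continuous (f : star s -> star t) :=
  internal f /\ forall x, S_continuous_at f x.

End Maps.

Definition S_homotopic (R : realType)
    (sI : std_uniform (stdU N) (set_type (unit_interval R)))
    (X Y : uniformType) (s : std_set (stdU N) X) (t : std_set (stdU N) Y)
    (f g : star s -> star t) :=
  exists h : star (std_prod (stdU_ZC N) s sI) -> star t,
    [/\ S_continuous h,
        forall x, h (star_pair x (star_of sI (I0 R))) = f x &
        forall x, h (star_pair x (star_of sI (I1 R))) = g x].

Definition S_retraction (X : uniformType) (s : std_set (stdU N) X)
    (A : set X) (a : std_subset s A) (r : star s -> star (std_sub a)) :=
  S_continuous r /\ forall y, r (star_incl y) = y.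

Definition S_deformation_retraction (R : realType)
    (sI : std_uniform (stdU N) (set_type (unit_interval R)))
    (X : uniformType) (s : std_set (stdU N) X)
    (A : set X) (a : std_subset s A) (r : star s -> star (std_sub a)) :=
  S_retraction r /\ S_homotopic sI (@star_incl _ _ _ a \o r) id.

End Star.

(* Main.v *)
(* In the standard universe, density and choice give for each entourage E a
   retraction X -> A that fixes A and moves every point by at most E. Saturation
   provides an internal entourage d contained in *E for every standard entourage
   E; by transfer there is an internal retraction r for d, so r x is infinitely
   close to x for every x, which makes r S-continuous. For the same reason any
   internal h with h(x,t) equal to r x or x is S-continuous: take h(x,t) = r x
   for t <> 1 and h(x,1) = x. *)

Require Import Defs.
From mathcomp Require Import all_boot all_order all_algebra.
From mathcomp Require Import all_classical all_reals all_analysis.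
Import numFieldNormedType.Exports.
Import Defs.

Set Implicit Arguments.
Unset Strict Implicit.
Unset Printing Implicit Defensive.
Local Open Scope classical_set_scope.

(** * Definable properties and their transfer *)

(** [P] ranges over all structures at once, so that one formula describes it in both universes;
    properties can then be stated directly, without de Bruijn indices. *)
Definition definable (P : forall M : eps_structure, (nat -> M) -> Prop) :=
  exists phi, forall (M : eps_structure) (v : nat -> M), sat v phi <-> P M v.

Lemma definable_eps i j : definable (fun M v => eps (v i) (v j)).
Proof. by exists (fEps i j). Qed.

Lemma definable_eq i j : definable (fun M v => v i = v j).
Proof. by exists (fEq i j). Qed.

Lemma definable_pair i j k : definable (fun M v => is_pair (v i) (v j) (v k)).
Proof. by exists (fPair i j k) => M v; exact: sat_pair. Qed.

Lemma definable_not P : definable P -> definable (fun M v => ~ P M v).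
Proof. by move=> [a ha]; exists (fNot a) => M v /=; rewrite ha. Qed.

Lemma definable_and P Q : definable P -> definable Q ->
  definable (fun M v => P M v /\ Q M v).
Proof. by move=> [a ha] [b hb]; exists (fAnd a b) => M v /=; rewrite ha hb. Qed.

Lemma definable_or P Q : definable P -> definable Q ->
  definable (fun M v => P M v \/ Q M v).
Proof.
by move=> [a ha] [b hb]; exists (fOr a b) => M v; rewrite sat_or ha hb.
Qed.

Lemma definable_imp P Q : definable P -> definable Q ->
  definable (fun M v => P M v -> Q M v).
Proof.
by move=> [a ha] [b hb]; exists (fImp a b) => M v; rewrite sat_imp ha hb.
Qed.

Lemma definable_iff P Q : definable P -> definable Q ->
  definable (fun M v => P M v <-> Q M v).
Proof.
by move=> [a ha] [b hb]; exists (fIff a b) => M v; rewrite sat_iff ha hb.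
Qed.

(** Under the quantifier the bound variable takes index 0 and the others shift by one; on
    [scons x v] this gives back [P M v x] by computation. *)
Lemma definable_all (P : forall M : eps_structure, (nat -> M) -> M -> Prop) :
  definable (fun M v => P M (fun n => v n.+1) (v 0%N)) ->
  definable (fun M v => forall x, P M v x).
Proof.
move=> [a ha]; exists (fAll a) => M v.
by split=> h x; [apply/(ha M (scons x v))|apply/(ha M (scons x v))]; exact: h.
Qed.

Lemma definable_ex (P : forall M : eps_structure, (nat -> M) -> M -> Prop) :
  definable (fun M v => P M (fun n => v n.+1) (v 0%N)) ->
  definable (fun M v => exists x, P M v x).
Proof.
move=> [a ha]; exists (fEx a) => M v; rewrite sat_ex.
by split=> -[x h]; exists x; apply/(ha M (scons x v)).
Qed.

Ltac definability := repeat (cbn beta iota; first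
  [ exact: definable_eps | exact: definable_eq | exact: definable_pair
  | apply: definable_not | apply: definable_and | apply: definable_or
  | apply: definable_iff | apply: definable_imp
  | apply: definable_all | apply: definable_ex ]).

Lemma transfer (P : forall M : eps_structure, (nat -> M) -> Prop) N v :
  definable P -> P (stdU N) v -> P (intU N) (emb N \o v).
Proof. by move=> [a ha] /ha /(emb_elementary N) /ha. Qed.

(* Splits the goal into the statement about the standard universe and the use of
   its transfer. *)
Tactic Notation "by_transfer" uconstr(P) uconstr(v) :=
  lapply (@transfer P _ v ltac:(definability)); last first.

(** * Separation and choice functions inside a model of [ZC] *)

Lemma separation (P : forall M : eps_structure, (nat -> M) -> Prop)
    (M : eps_structure) (v : nat -> M) a : ZC M -> definable P ->
  exists b, forall z, eps z b <-> eps z a /\ P M (scons z v).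
Proof.
move=> ZM [phi h]; have [b hb] := ZC_separation ZM phi v a.
by exists b => z; rewrite hb h.
Qed.

(** Pairs enter only through [is_pair], which keeps the notion definable; the second clause gives
    existence and uniqueness of the value at once. *)
Definition is_fun (M : eps_structure) (g c d : M) :=
  (forall z, eps z g -> exists x y, eps x c /\ eps y d /\ is_pair z x y) /\
  (forall x, eps x c -> exists y, eps y d /\
     forall z y', is_pair z x y' -> (eps z g <-> y' = y)).

(** [ZC_choice] asks for disjoint nonempty sets. It is applied to the fibres of [e] over the points
    of [c], disjoint because a pair determines its first coordinate; the choice set cut down to [e]
    is the graph. *)
Lemma uniformization (M : eps_structure) (e c d : M) : ZC M ->
  (forall z, eps z e -> exists x y, eps x c /\ eps y d /\ is_pair z x y) ->
  (forall x, eps x c -> exists z y, eps z e /\ is_pair z x y) ->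
  exists g, is_fun g c d /\ forall z, eps z g -> eps z e.
Proof.
move=> ZM esub etot.
pose fibre (K x : M) :=
  forall z, eps z K <-> eps z e /\ exists y, is_pair z x y.
have [p hp] := ZC_power ZM e.
have [F hF] : exists F, forall K, eps K F <->
    eps K p /\ exists x, eps x c /\ fibre K x.
  apply: (separation (P := fun M v => exists x, eps x (v 1%N) /\
    forall z, eps z (v 0%N) <-> eps z (v 2) /\ exists y, is_pair z x y)
    (scons c (fun=> e)) p ZM).
  definability.
have fibre_ex x : eps x c -> exists K, eps K F /\ fibre K x.
  move=> xc.
  have [K hK] := separation
    (P := fun M v => exists y, is_pair (v 0%N) (v 1%N) y)
    (scons x (fun=> x)) e ZM ltac:(definability).
  exists K; split=> //; apply/hF; split; last by exists x.
  by apply/hp => z /hK[].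
have [] := ZC_choice ZM (a := F).
- move=> K /hF[_ [x [xc hK]]]; have [z [y [ze zxy]]] := etot x xc.
  by exists z; apply/hK; split=> //; exists y.
- move=> K K' z /hF[_ [x [_ hK]]] /hF[_ [x' [_ hK']]] /hK[_ [y zxy]].
  move=> /hK'[_ [y' zxy']]; have [xx' _] := is_pair_inj zxy zxy'.
  by subst x'; apply: (ZC_ext ZM) => t; rewrite hK hK'.
move=> k hk.
have [g hg] := separation (P := fun M v => eps (v 0%N) (v 1%N)) (fun=> k) e ZM
  (definable_eps _ _).
exists g; split; last by move=> z /hg[].
split=> [z /hg[ze _]|x xc]; first exact: esub.
have [K [KF hK]] := fibre_ex x xc.
have [z0 [[/hK[z0e [y z0xy]] z0k] z0uniq]] := hk K KF.
exists y; split.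
  have [x' [y' [_ [y'd]]]] := esub z0 z0e.
  by move=> /(is_pair_inj z0xy)[_ ->].
move=> z y' zxy'; rewrite hg /=; split.
  move=> [ze zk].
  have /z0uniq z0z : eps z K /\ eps z k.
    by split=> //; apply/hK; split=> //; exists y'.
  by subst z; have [_ ->] := is_pair_inj z0xy zxy'.
by move=> y'y; subst y'; rewrite (is_pair_uniq ZM zxy' z0xy).
Qed.

(** * Pairs and functions in the internal universe *)

Section Star.
Variable N : nonstandard_universe.
Local Notation U := (stdU N).
Let ZU : ZC U := stdU_ZC N.

Lemma star_inj T (s : std_set U T) (x y : star s) : sval x = sval y -> x = y.
Proof. by move: x y => [x ?] [y ?] /= h; exact: eq_exist. Qed.

Lemma int_pair (a b : intU N) : exists p, is_pair p a b.
Proof.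
(* The sentence is closed; the infinite set merely supplies some element for the valuation. *)
by_transfer (fun M v => forall a b, exists p, is_pair p a b)
  (fun=> sval (cid (ZC_infinity ZU))).
  by move=> x y; exact: is_pair_ex.
by apply.
Qed.

Lemma star_pairP S T (s : std_set U S) (t : std_set U T) (x : star s)
    (y : star t) : is_pair (sval (star_pair x y)) (sval x) (sval y).
Proof. exact: (svalP (cid (star_pair_subproof x y))). Qed.

Lemma star_prod_ex S T (s : std_set U S) (t : std_set U T)
    (p : star (std_prod ZU s t)) :
  exists (x : star s) (y : star t), is_pair (sval p) (sval x) (sval y).
Proof.
(* The parameters are listed by [nth]; its default value lies beyond the indices that the statement
   reads. *)
by_transfer (fun M v => forall p, eps p (v 0%N) ->
    exists x y, eps x (v 1%N) /\ eps y (v 2) /\ is_pair p x y)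
  (nth (code (std_prod ZU s t)) [:: code (std_prod ZU s t); code s; code t]).
  move=> q /codeP[[x y] ->].
  exists (enc s x), (enc t y); split; first by apply/codeP; exists x.
  by split; [apply/codeP; exists y|exact: kpairP].
move=> /(_ (sval p) (svalP p)) [x [y [xs [yt pxy]]]].
by exists (exist _ x xs), (exist _ y yt).
Qed.

(** Turns an internal graph into an actual map, by choice outside the universes; the graph identity
    is what [internal] requires. *)
Lemma star_fun S T (s : std_set U S) (t : std_set U T) (g : intU N) :
  is_fun g (emb N (code s)) (emb N (code t)) ->
  exists f : star s -> star t, forall z, eps z g <->
    exists x, is_pair z (sval x) (sval (f x)).
Proof.
move=> [gsub gfun].
have /choice[f hf] : forall x : star s, exists y : star t,
    forall z y', is_pair z (sval x) y' -> (eps z g <-> y' = sval y).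
  move=> x; have [y [yt hy]] := gfun (sval x) (svalP x).
  by exists (exist _ y yt).
exists f => z; split=> [zg|[x zx]]; last exact/(hf x z _ zx).
have [x [y [xs [_ zxy]]]] := gsub z zg.
by exists (exist _ x xs); rewrite -((hf (exist _ x xs) z y zxy).1 zg).
Qed.

(** * Infinite closeness *)

Section InfClose.
Variables (X : uniformType) (s : std_uniform U X).

(** The inverse of an entourage of [X] is an entourage, hence coded, and the reversal of pairs
    between the two codes transfers. *)
Lemma inf_close_sym (x y : star s) : inf_close x y -> inf_close y x.
Proof.
move=> xy E e entE eE; have entE' := entourage_inv entE.
have [e' e'E'] := us_entourage s entE'.
have [p [pxy pe']] := xy _ _ entE' e'E'.
by_transfer (fun M v => forall p, eps p (v 0%N) ->
    forall x y, is_pair p x y -> forall q, is_pair q y x -> eps q (v 1%N))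
  (nth e [:: e'; e]).
  move=> q /e'E'[a [b [Eba qab]]] c d qcd r rdc.
  have [ca db] := is_pair_inj qcd qab.
  by apply/eE; exists b, a; rewrite -ca -db.
move=> h; have [q qyx] := int_pair (sval y) (sval x).
by exists q; split=> //; exact: h pe' _ _ pxy _ qyx.
Qed.

(** Take a coded [F] whose composite with itself lies in [E], and transfer this inclusion. *)
Lemma inf_close_trans (y x z : star s) :
  inf_close x y -> inf_close y z -> inf_close x z.
Proof.
move=> xy yz E e entE eE.
have [F entF FE] := entourage_split_ex entE.
have [f fF] := us_entourage s entF.
have [p [pxy pf]] := xy _ _ entF fF; have [q [qyz qf]] := yz _ _ entF fF.
by_transfer (fun M v => forall p q, eps p (v 0%N) -> eps q (v 0%N) ->
    forall x y z, is_pair p x y -> is_pair q y z ->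
    forall r, is_pair r x z -> eps r (v 1%N))
  (nth e [:: f; e]).
  move=> p' q' /fF[a [b [Fab pab]]] /fF[b' [c [Fbc qbc]]] x' y' z'.
  move=> pxy' qyz' r rxz.
  have [xa yb] := is_pair_inj pxy' pab.
  have [yb' zc] := is_pair_inj qyz' qbc; subst x' y' z'.
  have bb' : b = b' := enc_inj yb'; subst b'.
  by apply/eE; exists a, c; split=> //; apply: FE; exists b.
move=> h; have [r rxz] := int_pair (sval x) (sval z).
by exists r; split=> //; exact: h pf qf _ _ _ pxy qyz _ rxz.
Qed.

(** An entourage of the subspace contains the trace of an entourage of [X]. Closeness in [A] can
    thus be checked in [X]. *)
Lemma inf_close_sub (A : set X) (a : std_subset s A) (x y : star (std_sub a)) :
  inf_close (star_incl x) (star_incl y) -> inf_close x y.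
Proof.
move=> xy E e [F entF FE] eE; have [f fF] := us_entourage s entF.
have [p [pxy pf]] := xy _ _ entF fF; exists p; split=> //.
by_transfer (fun M v => forall p, eps p (v 0%N) -> forall x y,
    eps x (v 1%N) -> eps y (v 1%N) -> is_pair p x y -> eps p (v 2))
  (nth e [:: f; sub_code a; e]).
  move=> q /fF[b [c [Fbc qbc]]] _ _ /std_sub_codeP[x' ->]
    /std_sub_codeP[y' ->] qxy.
  have [xb yc] := is_pair_inj qxy qbc.
  apply/eE; exists x', y'; split=> //; apply: FE.
  by move: Fbc; rewrite -(enc_inj xb) -(enc_inj yc).
move=> h; exact: h pf _ _ (svalP x) (svalP y) pxy.
Qed.

(** Closeness in the product tests coded entourages only, so the work lies in coding the cylinder
    over [E]. *)
Lemma inf_close_fst (Y : uniformType) (t : std_set U Y)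
    (p q : star (std_prod ZU s t)) (x y : star s) (a b : star t) :
  is_pair (sval p) (sval x) (sval a) -> is_pair (sval q) (sval y) (sval b) ->
  inf_close (X := (X * Y)%type) p q -> inf_close x y.
Proof.
move=> pxa qyb pq E e entE eE.
pose E' : set ((X * Y) * (X * Y)) := [set z | E (z.1.1, z.2.1)].
have entE' : entourage E'.
  have : entourage [set z : (X * Y) * (X * Y) |
    E (z.1.1, z.2.1) /\ setT (z.1.2, z.2.2)] := prod_entP entE entourageT.
  by apply: filterS => z [].
pose c := code (std_prod ZU s t).
have [cc hcc] := prod_ex ZU c c.
(* [P] says that two points of the product have first coordinates related by [v 1]; it cuts the code
   of the cylinder out of the square of the product. *)
pose P (M : eps_structure) (v : nat -> M) := exists p q x y a b r,
  is_pair (v 0%N) p q /\ is_pair p x a /\ is_pair q y b /\ is_pair r x y /\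
  eps r (v 1%N).
have defP : definable P by rewrite /P; definability.
have [e' he'] := separation (fun=> e) cc ZU defP.
have e'E' : codes_rel (std_prod ZU s t) e' E'.
  move=> z; rewrite he' hcc; split.
    move=> [[_ [_ [/codeP[[x1 a1] ->] /codeP[[y1 b1] ->] zpq]]]].
    move=> [p' [q' [x' [y' [a' [b' [r [zpq' [pxa' [qyb' [rxy /eE]]]]]]]]]]] /=.
    have [pp qq] := is_pair_inj zpq' zpq; subst p' q'.
    have [xx _] := is_pair_inj pxa' (kpairP ZU _ _).
    have [yy _] := is_pair_inj qyb' (kpairP ZU _ _).
    move=> [x2 [y2 [Exy rxy2]]]; have [xx2 yy2] := is_pair_inj rxy rxy2.
    exists (x1, a1), (y1, b1); split=> //; rewrite /E' /=.
    have <- : x2 = x1 by apply: (@enc_inj _ _ s); rewrite -xx2 xx.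
    by have <- : y2 = y1 by apply: (@enc_inj _ _ s); rewrite -yy2 yy.
  move=> [[x1 a1] [[y1 b1] [Exy zpq]]]; split.
    exists (enc (std_prod ZU s t) (x1, a1)), (enc (std_prod ZU s t) (y1, b1)).
    by split=> //; apply/codeP; [exists (x1, a1)|exists (y1, b1)].
  exists (enc (std_prod ZU s t) (x1, a1)), (enc (std_prod ZU s t) (y1, b1)).
  exists (enc s x1), (enc s y1), (enc t a1), (enc t b1).
  have [r rxy] := is_pair_ex ZU (enc s x1) (enc s y1).
  exists r; do ![split=> //]; [exact: kpairP|exact: kpairP|].
  by apply/eE; exists x1, y1.
have [z [zpq ze']] := pq _ _ entE' e'E'.
by_transfer (fun M v => forall z, eps z (v 0%N) ->
    exists p q x y a b r, is_pair z p q /\ is_pair p x a /\ is_pair q y b /\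
    is_pair r x y /\ eps r (v 1%N)) (nth e [:: e'; e]).
  by move=> z' /he'[].
move=> h.
have [p' [q' [x' [y' [a' [b' [r [zpq' [pxa' [qyb' [rxy re]]]]]]]]]]] := h z ze'.
have [pp qq] := is_pair_inj zpq' zpq; subst p' q'.
have [xx _] := is_pair_inj pxa' pxa; have [yy _] := is_pair_inj qyb' qyb.
by exists r; rewrite -xx -yy.
Qed.

(** * Saturation: an infinitesimal internal entourage *)

(** The type asks of [d] to be an internal entourage inside the star of each standard one. It is
    finitely satisfiable since entourages are closed under finite intersections, and its parameters
    lie in the range of [emb], so saturation applies. *)
Lemma infinitesimal_entourage (w : U) :
  (forall e, eps e w <->
    exists E : set (X * X), entourage E /\ codes_rel s e E) ->
  exists d, eps d (emb N w) /\ forall E e, entourage E -> codes_rel s e E ->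
    forall z, eps z d -> eps z (emb N e).
Proof.
move=> hw.
pose P (M : eps_structure) (v : nat -> M) := eps (v 0%N) (v 1%N) /\
  forall z, eps z (v 0%N) -> eps z (v 2).
have [phi hphi] : definable P by rewrite /P; definability.
pose params (e : U) : nat -> intU N := scons (emb N w) (fun=> emb N e).
pose tp := [set q : formula * (nat -> intU N) | exists E e,
  [/\ entourage E, codes_rel s e E & q = (phi, params e)]].
(* Induction on the size of [F]: the full relation serves for the empty set, and each further
   formula is met by intersecting with its entourage. *)
have fin (F : set (formula * (nat -> intU N))) : finite_set F -> F `<=` tp ->
    exists E e, [/\ entourage E, codes_rel s e E & forall q, F q ->
      sat (scons (emb N e) q.2) q.1].
  case/finite_setP=> n; elim: n F => [|n IH] F.
    rewrite II0 card_eq0 => /eqP-> _; exists setT.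
    have [e eT] := us_entourage s (@entourageT X).
    by exists e; split=> //; exact: entourageT.
  move=> /eq_cardSP[q Fq /IH {}IH] Ftp.
  have [|G [g [entG gG hg]]] := IH; first by move=> r [/Ftp].
  have [E [e [entE eE qe]]] := Ftp q Fq.
  have entGE : entourage (G `&` E) by exact: filterI.
  have [d dGE] := us_entourage s entGE.
  have dw : eps (emb N d) (emb N w).
    apply: (@transfer (fun M v => eps (v 0%N) (v 1%N)) N (nth w [:: d; w])).
      exact: definable_eps.
    by apply/hw; exists (G `&` E).
  have sub H h : G `&` E `<=` H -> codes_rel s h H ->
      forall z, eps z (emb N d) -> eps z (emb N h).
    move=> GEH hH.
    apply: (@transfer (fun M v => forall z, eps z (v 0%N) -> eps z (v 1%N)) N
      (nth h [:: d; h])); first by definability.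
    by move=> z /dGE[x [y [/GEH Hxy zxy]]]; apply/hH; exists x, y.
  exists (G `&` E), d; split=> // r Fr.
  have [E' [e' [_ _ re']]] := Ftp r Fr.
  have [rq|rq] := pselect (r = q).
    rewrite rq qe /=; apply/hphi; split=> //=.
    by apply: sub eE => z [].
  have := hg r (conj Fr rq); rewrite re' /= !(propext (hphi _ _)).
  move=> [_ /= ge']; split=> //= z zd; apply: ge'.
  by apply: sub gG _ zd => y [].
have [//|||d hd] := @intU_saturated N (range (emb N)) tp.
- exact: card_image_le.
- by move=> _ [E [e [_ _ ->]]] [|n] /=; [exists w|exists e].
- by move=> F /fin{}fin /fin[E [e [_ _ h]]]; exists (emb N e).
have dP E e : entourage E -> codes_rel s e E ->
    P (intU N) (scons d (params e)).
  by move=> entE eE; apply/hphi/(hd (phi, params e)); exists E, e.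
exists d; split=> [|E e entE eE]; last by have [] := dP E e entE eE.
(* Every formula of the type contains the membership in [emb N w]; the one of the full relation is
   used. *)
have [e eT] := us_entourage s (@entourageT X).
by have [] := dP _ _ (@entourageT X) eT.
Qed.

End InfClose.
End Star.

(** * Retractions and homotopies controlled by an entourage *)

(* [g] is the graph of a retraction [X -> A] moving points by at most the
   entourage [e], and [h], with domain [P] the product of [X] and an interval
   with endpoints [o] and [i], that of an equally small homotopy from [g] to the
   identity. *)
Definition near_retraction (M : eps_structure) (e X A P o i g h : M) :=
  [/\ is_fun g X A /\ is_fun h P X,
      (forall z, eps z g -> eps z e) /\
        (forall a, eps a A -> forall z, is_pair z a a -> eps z g),
      forall z p y x t q, eps z h -> is_pair z p y -> is_pair p x t ->
        is_pair q x y -> eps q e &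
      (forall z p y x q, eps z h -> is_pair z p y -> is_pair p x o ->
        is_pair q x y -> eps q g) /\
        (forall z p y x, eps z h -> is_pair z p y -> is_pair p x i -> y = x)].

Lemma definable_near_retraction e X A P o i g h :
  definable (fun M v => near_retraction (v e) (v X) (v A) (v P) (v o) (v i)
    (v g) (v h)).
Proof.
(* The several-fold conjunctions are replaced by nested binary ones, for which [definability] finds
   a formula. *)
have [phi hphi] : definable (fun M v =>
    (is_fun (v g) (v X) (v A) /\ is_fun (v h) (v P) (v X)) /\
    ((forall z, eps z (v g) -> eps z (v e)) /\
      (forall a, eps a (v A) -> forall z, is_pair z a a -> eps z (v g))) /\
    (forall z p y x t q, eps z (v h) -> is_pair z p y -> is_pair p x t ->
      is_pair q x y -> eps q (v e)) /\
    ((forall z p y x q, eps z (v h) -> is_pair z p y -> is_pair p x (v o) ->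
      is_pair q x y -> eps q (v g)) /\
    (forall z p y x, eps z (v h) -> is_pair z p y -> is_pair p x (v i) ->
      y = x))).
  by rewrite /is_fun; definability.
exists phi => M v; rewrite hphi /near_retraction.
by split=> [[? [? [? ?]]]|[? ? ? ?]].
Qed.

Lemma near_retraction_ex (U : eps_structure) (ZU : ZC U) (X : uniformType)
    (s : std_set U X) (A : set X) (a : std_subset s A) (I : Type)
    (t : std_set U I) (t0 t1 : I) (E : set (X * X)) (e : U) :
  dense A -> t0 <> t1 -> entourage E -> codes_rel s e E ->
  exists g h, near_retraction e (code s) (sub_code a)
    (code (std_prod ZU s t)) (enc t t0) (enc t t1) g h.
Proof.
move=> dA t01 entE eE.
have [xa hxa] := prod_ex ZU (code s) (sub_code a).
(* [e0] is the part of [e] with values in [A] that is diagonal over [A]; a function inside it is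
   automatically a retraction. *)
have [e0 he0] : exists e0, forall z, eps z e0 <-> eps z xa /\ eps z e /\
    forall x y, is_pair z x y -> eps x (sub_code a) -> y = x.
  apply: (separation (P := fun M v => eps (v 0%N) (v 1%N) /\
    forall x y, is_pair (v 0%N) x y -> eps x (v 2) -> y = x)
    (scons e (fun=> sub_code a)) xa ZU).
  definability.
have [||g [gfun ge0]] := uniformization (e := e0) (c := code s)
    (d := sub_code a) ZU.
- by move=> z /he0[/hxa[x [y [xs ya zxy]]] _]; exists x, y.
- move=> _ /codeP[x ->].
  (* Totality of [e0]: a point of [A] is its own value; otherwise density gives a point of [A] in
     the interior of the section of [E] at [x]. *)
  have [y [Ay [Exy Axy]]] : exists y, A y /\ E (x, y) /\ (A x -> y = x).
    have [Ax|nAx] := pselect (A x).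
      by exists x; do 2!split=> //; exact: entourage_refl.
    have xE : nbhs x (xsection E x) by exact: nbhs_entourage.
    have [||y [/interior_subset yE Ay]] := dA (xsection E x)^°.
    - by exists x.
    - exact: open_interior.
    by exists y; split=> //; split; [move: yE; rewrite /xsection /= inE|].
  exists (kpair ZU (enc s x) (enc s y)), (enc s y).
  split; last exact: kpairP.
  apply/he0; split.
    apply/hxa; exists (enc s x), (enc s y); split; last exact: kpairP.
      by apply/codeP; exists x.
    by apply/sub_codeP; exists y.
  split; first by apply/eE; exists x, y; split=> //; exact: kpairP.
  move=> x' y' /(is_pair_inj (kpairP ZU _ _))[<- <-] /sub_codeP[x1 [Ax1 xx1]].
  have {}xx1 : x = x1 := enc_inj xx1.
  by subst x1; rewrite Axy.
have ge z : eps z g -> eps z e by move=> /ge0/he0[_ []].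
have gdiag b : eps b (sub_code a) -> forall z, is_pair z b b -> eps z g.
  move=> ba z zbb; have [x [_ xb]] := (sub_codeP a b).1 ba.
  have bs : eps b (code s) by apply/codeP; exists x.
  have [y [_ hy]] := gfun.2 b bs; apply/(hy _ _ zbb).
  have [q qby] := is_pair_ex ZU b y.
  have /ge0/he0[_ [_ /(_ _ _ qby ba)->]] // : eps q g by apply/(hy _ _ qby).
have [xp hxp] := prod_ex ZU (code (std_prod ZU s t)) (code s).
(* The homotopy is the identity at time [t1] and [g] at all other times. *)
have [h hh] : exists h, forall z, eps z h <-> eps z xp /\
    exists p y x u q, is_pair z p y /\ is_pair p x u /\ is_pair q x y /\
      ((u = enc t t1 /\ y = x) \/ (u <> enc t t1 /\ eps q g)).
  apply: (separation (P := fun M v => exists p y x u q,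
      is_pair (v 0%N) p y /\ is_pair p x u /\ is_pair q x y /\
      ((u = v 1%N /\ y = x) \/ (u <> v 1%N /\ eps q (v 2))))
    (scons (enc t t1) (fun=> g)) xp ZU).
  definability.
(* By injectivity of pairs, the case distinction defining [h] holds for any given decomposition of
   [z]. *)
have hP z p y x u q : eps z h -> is_pair z p y -> is_pair p x u ->
    is_pair q x y -> (u = enc t t1 /\ y = x) \/ (u <> enc t t1 /\ eps q g).
  move=> /hh[_ [p' [y' [x' [u' [q' [zpy' [pxu' [qxy' yu]]]]]]]]] zpy pxu qxy.
  have [pp yy] := is_pair_inj zpy zpy'; subst p' y'.
  have [xx uu] := is_pair_inj pxu pxu'; subst x' u'.
  by rewrite (is_pair_uniq ZU qxy qxy').
exists g, h; split; last 1 first.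
- split=> [z p y x q zh zpy pxo qxy|z p y x zh zpy pxi].
    have ne : enc t t0 <> enc t t1 by move=> /(@enc_inj _ _ t).
    by have [[/ne]|[]] := hP _ _ _ _ _ _ zh zpy pxo qxy.
  have [q qxy] := is_pair_ex ZU x y.
  by have [[]|[]] := hP _ _ _ _ _ _ zh zpy pxi qxy.
- split=> //; split.
    by move=> z /hh[/hxp[p [y [? ? ?]]] _]; exists p, y.
  move=> _ /codeP[[x u] ->]; set p := enc _ _.
  have pxu : is_pair p (enc s x) (enc t u) by exact: kpairP.
  have ps : eps p (code (std_prod ZU s t)) by apply/codeP; exists (x, u).
  have xs : eps (enc s x) (code s) by apply/codeP; exists x.
  have [u1|u1] := pselect (u = t1).
    exists (enc s x); split=> // z y' zpy'; split=> [zh|y'x].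
      have [q qxy'] := is_pair_ex ZU (enc s x) y'.
      by have [[]|[]] := hP _ _ _ _ _ _ zh zpy' pxu qxy'; rewrite u1.
    have [q qxy'] := is_pair_ex ZU (enc s x) y'.
    apply/hh; split; first by apply/hxp; exists p, y'; rewrite y'x in zpy' *.
    exists p, y', (enc s x), (enc t u), q.
    by do 3!split=> //; left; rewrite u1.
  have nu1 : enc t u <> enc t t1 by move=> /(@enc_inj _ _ t).
  have [y [ya hy]] := gfun.2 _ xs.
  have ys : eps y (code s).
    by move: ya => /sub_codeP[y1 [_ ->]]; apply/codeP; exists y1.
  exists y; split=> // z y' zpy'.
  have [q qxy'] := is_pair_ex ZU (enc s x) y'; split=> [zh|y'y].
    by have [[]|[_ /(hy _ _ qxy')]] := hP _ _ _ _ _ _ zh zpy' pxu qxy'.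
  apply/hh; split; first by apply/hxp; exists p, y'; rewrite y'y in zpy' *.
  exists p, y', (enc s x), (enc t u), q.
  by do 3!split=> //; right; split=> //; apply/(hy _ _ qxy').
- by [].
- move=> z p y x u q zh zpy pxu qxy.
  have [[_ yx]|[_ /ge//]] := hP _ _ _ _ _ _ zh zpy pxu qxy.
  (* At time [t1] the point does not move, and [E] contains the diagonal. *)
  subst y; move: zh => /hh[/hxp[p' [y' [_ /codeP[x1 y'x1] zpy']]] _].
  have [_ xy'] := is_pair_inj zpy zpy'.
  by apply/eE; exists x1, x1; split; [exact: entourage_refl|rewrite -y'x1 -xy'].
Qed.

(** * The internal retraction and homotopy *)

Theorem theorem12 (N : nonstandard_universe) (R : realType)
  (sI : std_uniform (stdU N) (set_type (unit_interval R)))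
  (X : uniformType) (sX : std_uniform (stdU N) X)
  (A : set X) (sA : std_subset sX A) :
  dense A ->
  exists r : star sX -> star (std_sub sA), S_deformation_retraction sI r.
Proof.
move=> dA; pose ZU := stdU_ZC N.
have [w hw] := us_uniformity sX.
have [d [dw dinf]] := infinitesimal_entourage hw.
have I01 : I0 R <> I1 R.
  by move=> /(congr1 sval) /= /esym/eqP; rewrite GRing.oner_eq0.
(* Quantifying over all members of [w] makes the transferred statement apply to every internal
   entourage, hence to the infinitesimal [d]. *)
lapply (@transfer (fun M v => forall e, eps e (v 0%N) -> exists g h,
    near_retraction e (v 1%N) (v 2) (v 3) (v 4) (v 5) g h) N
  (nth w [:: w; code sX; sub_code sA; code (std_prod ZU sX sI);
     enc sI (I0 R); enc sI (I1 R)])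
  ltac:(definability; exact: definable_near_retraction)); last first.
  by move=> e /hw[E [entE eE]]; exact: near_retraction_ex eE.
move=> /(_ d dw)[g [h [[gfun hfun] [gd gdiag] hd [h0 h1]]]].
have [f fg] := star_fun (s := sX) (t := std_sub sA) gfun.
have [k kh] := star_fun (s := std_prod ZU sX sI) (t := sX) hfun.
(* The pair of [x] and [f x] lies in [d], hence in the star of every standard entourage. *)
have fclose x : inf_close x (star_incl (f x)).
  move=> E e entE eE; have [z zx] := int_pair (sval x) (sval (f x)).
  by exists z; split=> //; apply: (dinf _ _ entE eE); apply/gd/fg; exists x.
have kclose (p : star (std_prod ZU sX sI)) x (u : star sI) :
    is_pair (sval p) (sval x) (sval u) -> inf_close x (k p).
  move=> pxu E e entE eE; have [q qx] := int_pair (sval x) (sval (k p)).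
  exists q; split=> //; apply: (dinf _ _ entE eE).
  have [z zp] := int_pair (sval p) (sval (k p)).
  by apply: (hd z _ _ _ _ _ _ zp pxu qx); apply/kh; exists p.
exists f; split.
  split; last first.
    move=> y; have [z zy] := int_pair (sval y) (sval y).
    have /fg[x zx] := gdiag _ (svalP y) _ zy.
    have [yx yfx] := is_pair_inj zy zx; apply: star_inj.
    by rewrite yfx; congr (sval (f _)); exact: star_inj.
  split; first by exists g.
  (* The chain is $f(y)\approx y\approx x\approx f(x)$ in ${}^{\ast}X$. *)
  move=> x y yx; apply: inf_close_sub.
  apply: (inf_close_trans (y := x)); last exact: fclose.
  by apply: (inf_close_trans (y := y)) yx; exact: inf_close_sym.
exists k; split.
- split; first by exists h.
  move=> q p pq.
  have [x [u qxu]] := star_prod_ex q; have [y [u' pyu]] := star_prod_ex p.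
  (* Projecting to ${}^{\ast}X$ yields the chain $k(p)\approx y\approx x\approx k(q)$. *)
  have yx : inf_close y x := inf_close_fst pyu qxu pq.
  apply: (inf_close_trans (y := x)); last exact: kclose qxu.
  by apply: (inf_close_trans (y := y)) yx; apply: inf_close_sym;
    exact: kclose pyu.
- move=> x; set p := star_pair _ _; have px := star_pairP x (star_of sI (I0 R)).
  have [z zp] := int_pair (sval p) (sval (k p)).
  have [q qx] := int_pair (sval x) (sval (k p)).
  (* At time 0 the pair of [x] and [k p] belongs to the graph of [f]. *)
  have /fg[x' qx'] : eps q g.
    by apply: (h0 z _ _ _ _ _ zp px qx); apply/kh; exists p.
  have [xx kf] := is_pair_inj qx qx'; apply: star_inj; rewrite /= kf.
  by congr (sval (f _)); exact/esym/star_inj.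
- move=> x; set p := star_pair _ _; have px := star_pairP x (star_of sI (I1 R)).
  have [z zp] := int_pair (sval p) (sval (k p)).
  by apply: star_inj; apply: (h1 z _ _ _ _ zp px); apply/kh; exists p.
Qed.
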